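(* Let $B\subset\mathbb{R}^3$ be an open set, let $f=(f^4,f^5,f^6,f^7):B\to T^4$ be a smooth map, let $X=B\times T^4$ carry the flat metric and the standard $G_2$-structure $\varphi$, and let $S=\{(x,f(x))\mid x\in B\}\subset X$ be the graph of $f$. Let $\nabla^B=d+\sqrt{-1}\sum_{j=1}^3A^jdx^j$ be a Hermitian connection of the trivial complex line bundle $B\times\mathbb{C}\to B$, with $A^j:B\to\mathbb{R}$ smooth. Let $\nabla$ be the real Fourier--Mukai transform of $(S,\nabla^B)$, with curvature $F_\nabla\in\sqrt{-1}\,\Omega^2(X)$. Then the following are equivalent. (1) $S$ is an associative submanifold for an appropriate orientation and $\nabla^B$ is flat. (2) $\frac16F_\nabla^3+F_\nabla\wedge*\varphi=0$. (3) $\frac16F_\nabla^3+F_\nabla\wedge*\varphi=0$ and $\varphi\wedge*(F_\nabla^2)=0$.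
   Context: $T^4=\mathbb{R}^4/(2\pi\mathbb{Z})^4$. Coordinates on $B$ are $(x^1,x^2,x^3)$ and on $T^4$ are $(y^4,\dots,y^7)$; $X=B\times T^4$ has the flat metric $\sum(dx^i)^2+\sum(dy^a)^2$ and orientation $dx^{123}\wedge dy^{4567}$; $*$ is the Hodge star; powers of forms are wedge powers and $dx^{ij}=dx^i\wedge dx^j$, etc. Set $\omega_1=dy^{45}+dy^{67}$, $\omega_2=dy^{46}+dy^{75}$, $\omega_3=-(dy^{47}+dy^{56})$. The standard $G_2$-structure and its Hodge dual are $\varphi=dx^{123}+\sum_{i=1}^3dx^i\wedge\omega_i$ and $*\varphi=dy^{4567}+dx^{12}\wedge\omega_3+dx^{23}\wedge\omega_1+dx^{31}\wedge\omega_2$. Associative: an oriented 3-dimensional submanifold calibrated by $\varphi$, i.e. $\varphi$ restricts to the induced volume form. Real Fourier--Mukai transform of $(S,\nabla^B)$: identifying $B\times(T^4)^*$ with $X$, the Hermitian connection $\nabla=d+\sqrt{-1}\sum_{j=1}^3A^jdx^j+\sqrt{-1}\sum_{a=4}^7f^ady^a$ of the trivial complex line bundle over $X$. Its curvature is $F_\nabla=\sqrt{-1}\sum_{i,j=1}^3\frac{\partial A^j}{\partial x^i}dx^i\wedge dx^j+\sqrt{-1}\sum_{i=1}^3\sum_{a=4}^7\frac{\partial f^a}{\partial x^i}dx^i\wedge dy^a$. (The components $f^a$ are defined modulo $2\pi$, so their derivatives are well-defined functions on $B$.) *)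

(* Defs.v *)
From HB Require Import structures.
From mathcomp Require Import all_boot all_order all_algebra.
From mathcomp Require Import all_classical all_reals all_analysis.
From mathcomp Require Import complex.

Set Implicit Arguments.
Unset Strict Implicit.
Unset Printing Implicit Defensive.

Import Order.TTheory GRing.Theory Num.Theory.
Import numFieldNormedType.Exports.

Local Open Scope classical_set_scope.
Local Open Scope ring_scope.
Local Open Scope quotient_scope.

Reserved Notation "a \wedge b" (at level 40, left associativity).
Reserved Notation "a ^\wedge k" (at level 30, right associativity).

Section ExteriorAlgebra.
Variables (K : comNzRingType) (n : nat).

(* A constant-coefficient form sum_I alpha_I dx^I on R^n is stored as its
   coefficient family; dx^I is the wedge product of the dx^i, i in I, taken in
   increasing order. *)
Definition ext_form : Type := {ffun {set 'I_n} -> K^o}.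

Definition basis_form (I : {set 'I_n}) : ext_form := [ffun J => (J == I)%:R].

Definition covector (i : 'I_n) : ext_form := basis_form [set i]%SET.

(* dx^J /\ dx^L = shuffle_sign J L dx^(J u L) for disjoint J and L. *)
Definition shuffle_sign (J L : {set 'I_n}) : K :=
  (-1) ^+ #|[set p : 'I_n * 'I_n | [&& p.1 \in J, p.2 \in L & (p.2 < p.1)%N]]%SET|.

Definition wedge_prod (a b : ext_form) : ext_form :=
  [ffun I : {set 'I_n} => \sum_(J : {set 'I_n} | J \subset I)
     shuffle_sign J (I :\: J)%SET * a J * b (I :\: J)%SET].

Definition wedge_exp (a : ext_form) (k : nat) : ext_form :=
  iter k (wedge_prod a) (basis_form finset.set0).

(* Hodge star for the Euclidean metric and the orientation dx^0 /\ ... /\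
   dx^(n-1): star dx^I = shuffle_sign I (~: I) dx^(~: I), extended linearly. *)
Definition hodge (a : ext_form) : ext_form :=
  [ffun I : {set 'I_n} => shuffle_sign (~: I)%SET I * a (~: I)%SET].

(* Value of the degree k part of a on the rows of v: the summand of I uses the
   k x k minor of v on the columns I, listed increasingly by enum. *)
Definition form_eval (k : nat) (a : ext_form) (v : 'M[K]_(k, n)) : K :=
  \sum_(I : {set 'I_n} | #|I| == k)
     a I * \det (\matrix_(i < k, j < k) [seq v i c | c <- enum I]`_j).

End ExteriorAlgebra.

Arguments covector {K n} i.
Notation "a \wedge b" := (wedge_prod a b) : ring_scope.
Notation "a ^\wedge k" := (wedge_exp a k) : ring_scope.

Section G2.
Variable K : comNzRingType.

(* 'I_3 indexes x^1, x^2, x^3 and 'I_4 indexes y^4, ..., y^7, both from 0; the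
   coordinates of X are ordered x^1, ..., y^7. *)
Definition dx (i : 'I_3) : ext_form K (3 + 4) := covector (lshift 4 i).
Definition dy (a : 'I_4) : ext_form K (3 + 4) := covector (rshift 3 a).

Local Notation dx1 := (dx 0).
Local Notation dx2 := (dx 1).
Local Notation dx3 := (dx 2%:R).
Local Notation dy4 := (dy 0).
Local Notation dy5 := (dy 1).
Local Notation dy6 := (dy 2%:R).
Local Notation dy7 := (dy 3%:R).

Definition omega1 := dy4 \wedge dy5 + dy6 \wedge dy7.
Definition omega2 := dy4 \wedge dy6 + dy7 \wedge dy5.
Definition omega3 := - (dy4 \wedge dy7 + dy5 \wedge dy6).

Definition phi : ext_form K (3 + 4) :=
  dx1 \wedge dx2 \wedge dx3
  + (dx1 \wedge omega1 + dx2 \wedge omega2 + dx3 \wedge omega3).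

End G2.

Arguments phi {K}.

Section Smooth.
Variables (R : realType) (V W : normedModType R).

Fixpoint Ck_on (U : set V) (k : nat) (g : V -> W) : Prop :=
  match k with
  | 0 => forall x, U x -> {for x, continuous g}
  | k'.+1 => (forall x, U x -> differentiable g x) /\
             (forall v, Ck_on U k' ('D_v g))
  end.

Definition smooth_on (U : set V) (g : V -> W) : Prop := forall k, Ck_on U k g.

End Smooth.

Section Torus.
Variable R : realType.

Definition lattice_rel (u v : 'rV[R]_4) : bool :=
  `[< exists k : 'rV[int]_4, u - v = (2 * pi) *: map_mx intr k >].

Lemma lattice_rel_refl : reflexive lattice_rel.
Proof. by move=> u; apply/asboolP; exists 0; rewrite subrr map_mx0 scaler0. Qed.

Lemma lattice_rel_sym : symmetric lattice_rel.
Proof.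
suff h u v : lattice_rel u v -> lattice_rel v u by move=> u v; apply/idP/idP; exact: h.
move=> /asboolP[k uv]; apply/asboolP; exists (- k).
by rewrite map_mxN scalerN -uv opprB.
Qed.

Lemma lattice_rel_trans : transitive lattice_rel.
Proof.
move=> v u w /asboolP[k uv] /asboolP[l vw]; apply/asboolP; exists (k + l).
by rewrite map_mxD scalerDr -uv -vw subrKA.
Qed.

Definition lattice_equiv :=
  EquivRel lattice_rel lattice_rel_refl lattice_rel_sym lattice_rel_trans.

Definition torus : Type := quotient_topology {eq_quot lattice_equiv}.

Definition to_torus (v : 'rV[R]_4) : torus := \pi_torus v.

Definition local_lift (m : nat) (g : 'rV[R]_m -> torus) (x : 'rV[R]_m)
    (h : 'rV[R]_m -> 'rV[R]_4) : Prop :=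
  exists U : set 'rV[R]_m,
    [/\ open U, U x, smooth_on U h & forall y, U y -> g y = to_torus (h y)].

Definition torus_smooth_on (m : nat) (U : set 'rV[R]_m)
    (g : 'rV[R]_m -> torus) : Prop :=
  forall x, U x -> exists h, local_lift g x h.

(* Entry (i, a) is the partial derivative of the a-th component of g along the
   i-th coordinate at x. Two local lifts differ near x by a locally constant
   vector of the lattice, so the choice made by xget is immaterial. *)
Definition torus_jacobian (m : nat) (g : 'rV[R]_m -> torus) (x : 'rV[R]_m) :
    'M[R]_(m, 4) :=
  jacobian (xget (fun=> 0) [set h | local_lift g x h]) x.

End Torus.

Section Submanifolds.
Variable R : realType.

(* The ambient R^3 x T^4, of which B x T^4 is an open subset. *)
Definition ambient : Type := ('rV[R]_3 * torus R)%type.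

(* The rows are the three partial derivatives of psi, in the global frame
   d/dx^1, ..., d/dy^7 of the ambient space. *)
Definition tangent_frame (psi : 'rV[R]_3 -> ambient) (u : 'rV[R]_3) :
    'M[R]_(3, 3 + 4) :=
  row_mx (jacobian (fst \o psi) u) (torus_jacobian (snd \o psi) u).

(* psi is a smooth immersion of U which is a homeomorphism onto a relatively
   open subset of S. *)
Definition local_param (S : set ambient) (U : set 'rV[R]_3)
    (psi : 'rV[R]_3 -> ambient) : Prop :=
  [/\ open U,
      smooth_on U (fst \o psi) /\ torus_smooth_on U (snd \o psi),
      forall u, U u -> row_free (tangent_frame psi u),
      (forall u v, U u -> U v -> psi u = psi v -> u = v)
    & forall V, open V -> V `<=` U ->
        exists2 Z : set ambient, open Z & psi @` V = S `&` Z].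

(* An orientation of the 3-dimensional submanifold S, given by a covering
   family of local parametrizations whose tangent frames at common points
   differ by matrices of positive determinant. *)
Definition oriented_atlas (S : set ambient)
    (P : set (set 'rV[R]_3 * ('rV[R]_3 -> ambient))) : Prop :=
  [/\ forall c, P c -> local_param S c.1 c.2,
      forall p, S p -> exists c, P c /\ (c.2 @` c.1) p
    & forall c c' u u', P c -> P c' -> c.1 u -> c'.1 u' -> c.2 u = c'.2 u' ->
        exists2 M : 'M[R]_3, 0 < \det M &
          tangent_frame c.2 u = M *m tangent_frame c'.2 u'].

(* sqrt (det (v v^T)) is the induced Riemannian volume of the positive frame. *)
Definition calibrated (a : ext_form R (3 + 4))
    (P : set (set 'rV[R]_3 * ('rV[R]_3 -> ambient))) : Prop :=
  forall c u, P c -> c.1 u ->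
    let v := tangent_frame c.2 u in
    form_eval a v = Num.sqrt (\det (v *m v^T)).

Definition associative_for_some_orientation (S : set ambient) : Prop :=
  exists P, oriented_atlas S P /\ calibrated phi P.

Definition graph_over (B : set 'rV[R]_3) (f : 'rV[R]_3 -> torus R) :
    set ambient := [set p | B p.1 /\ p.2 = f p.1].

End Submanifolds.

Section FourierMukai.
Variable R : realType.
Variable A : 'I_3 -> 'rV[R]_3 -> R^o.

Definition imag (r : R) : R[i] := ('i * r%:C)%C.

Definition partial (i : 'I_3) (g : 'rV[R]_3 -> R^o) (x : 'rV[R]_3) : R :=
  'D_(delta_mx 0 i) g x.

(* The curvature of d + sqrt(-1) sum_j A^j dx^j. *)
Definition base_curvature (x : 'rV[R]_3) : ext_form R[i] 3 :=
  \sum_(i < 3) \sum_(j < 3)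
    imag (partial i (A j) x) *: (covector i \wedge covector j).

Definition flat_on (B : set 'rV[R]_3) : Prop :=
  forall x, B x -> base_curvature x = 0.

(* The curvature of the real Fourier-Mukai transform
   d + sqrt(-1) sum_j A^j dx^j + sqrt(-1) sum_a f^a dy^a of the graph of f with
   the above connection; it is invariant under translations of T^4. *)
Definition fm_curvature (f : 'rV[R]_3 -> torus R) (p : ambient R) :
    ext_form R[i] (3 + 4) :=
  \sum_(i < 3) \sum_(j < 3)
    imag (partial i (A j) p.1) *: (dx _ i \wedge dx _ j)
  + \sum_(i < 3) \sum_(a < 4)
      imag (torus_jacobian f p.1 i a) *: (dx _ i \wedge dy _ a).

End FourierMukai.

(* Main.v *)
Require Import Defs.
From HB Require Import structures.
From mathcomp Require Import all_boot all_order all_algebra.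
From mathcomp Require Import all_classical all_reals all_analysis.
From mathcomp Require Import complex.
From mathcomp Require Import ring lra.

Set Implicit Arguments.
Unset Strict Implicit.
Unset Printing Implicit Defensive.

Import Order.TTheory GRing.Theory Num.Theory.
Import numFieldNormedType.Exports.

Local Open Scope classical_set_scope.
Local Open Scope ring_scope.

(* Everything is pointwise in the partial derivatives A_ij of A and J_ia of f.
   Since F^3 sees only the dx /\ dy part of F, equation (2) splits into the
   dx^ij dy^4567 components, which say that dA = 0, and four equations
   chi_a(J) = 0, cubic in J. The chi_a are the dy components of the associator
   of the frame e_i + sum_a J_ia e_a of the graph. The associator is orthogonal
   to the frame, so its dx components are combinations of the chi_a, and by the
   associator equality vol^2 = phi^2 + |associator|^2 the chi_a all vanish if
   and only if phi = vol or phi = -vol on the frame. The dx components of the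
   associator are also the coefficients of phi /\ *F^2 once dA = 0, whence (3).
   The sign of phi is locally constant where phi^2 = vol^2 > 0; it dictates the
   orientation of the graph. *)

(** * Exterior algebra by computation on lists of terms *)

Section SparseForms.
Variables (K : comNzRingType) (n : nat).
Implicit Types (s t : seq (K * bitseq)) (a b : ext_form K n) (m : bitseq).

Lemma wedge_prodDl a1 a2 b : (a1 + a2) \wedge b = a1 \wedge b + a2 \wedge b.
Proof.
apply/ffunP => I; rewrite !ffunE -big_split; apply: eq_bigr => J _ /=.
by rewrite !ffunE mulrDr mulrDl.
Qed.

Lemma wedge_prodDr a b1 b2 : a \wedge (b1 + b2) = a \wedge b1 + a \wedge b2.
Proof.
apply/ffunP => I; rewrite !ffunE -big_split; apply: eq_bigr => J _ /=.
by rewrite !ffunE mulrDr.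
Qed.

Lemma wedge_prodZl (c : K) a b : (c *: a) \wedge b = c *: (a \wedge b).
Proof.
apply/ffunP => I; rewrite !ffunE [RHS]mulr_sumr; apply: eq_bigr => J _ /=.
by rewrite !ffunE /GRing.scale /=; ring.
Qed.

Lemma wedge_prodZr (c : K) a b : a \wedge (c *: b) = c *: (a \wedge b).
Proof.
apply/ffunP => I; rewrite !ffunE [RHS]mulr_sumr; apply: eq_bigr => J _ /=.
by rewrite !ffunE /GRing.scale /=; ring.
Qed.

(** In the coefficient of the product at [H] only the summand [L = I] survives, and it is nonzero
    only when [H] is the disjoint union of [I] and [J]. *)
Lemma wedge_basis (I J : {set 'I_n}) :
  basis_form K I \wedge basis_form K J =
  if I :&: J == finset.set0 then shuffle_sign K I J *: basis_form K (I :|: J) else 0.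
Proof.
rewrite finset.setI_eq0; apply/ffunP => H; rewrite ffunE.
have term0 L : L != I ->
    shuffle_sign K L (H :\: L) * basis_form K I L * basis_form K J (H :\: L) = 0.
  by move=> /negPf LI; rewrite !ffunE LI mulr0 mul0r.
have [sIH|nIH] := boolP (I \subset H); last first.
  rewrite big1 => [|L sLH]; last by apply: term0; apply: contraNneq nIH => <-.
  case: ifP => _; rewrite !ffunE //; case: eqP => [HE|_]; last by rewrite scaler0.
  by rewrite HE finset.subsetUl in nIH.
rewrite (bigD1 I) //= big1 ?addr0; last by move=> L /andP[_ /term0].
rewrite !ffunE eqxx mulr1.
case: ifP => [dIJ|nIJ]; rewrite !ffunE.
  have -> : (H :\: I == J) = (H == I :|: J).
    apply/eqP/eqP => [<-|->].
      by rewrite -{1}(finset.setID H I) (finset.setIidPr sIH).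
    rewrite finset.setDUl finset.setDv finset.set0U.
    by apply/finset.setDidPl; rewrite disjoint_sym.
  case: eqP => [->|_]; rewrite ?mulr0 ?scaler0 //; congr (_ * _).
  congr shuffle_sign; rewrite finset.setDUl finset.setDv finset.set0U.
  by apply/finset.setDidPl; rewrite disjoint_sym.
case: eqP => [HJ|_]; last by rewrite mulr0.
by move: nIJ; rewrite -HJ disjoint_sym -finset.setI_eq0 finset.setIDAC finset.setDIl
  finset.setDv finset.setI0 eqxx.
Qed.

(* A form is represented by a list of terms (c, m), where m is the indicator
   sequence of the index set of the term; wedge products and Hodge stars of
   such lists are found by computation, with symbolic coefficients. *)
Definition mask_set m : {set 'I_n} := [set i : 'I_n | nth false m i]%SET.

(** The inversion count of [shuffle_sign], as nested sums over lists of naturals, so that it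
    evaluates to a numeral. *)
Definition crossings (m1 m2 : bitseq) : nat :=
  sumn [seq sumn [seq [&& nth false m1 i, nth false m2 j & (j < i)%N] : nat
    | j <- iota 0 n] | i <- iota 0 n].

Definition flip_if (b : bool) (x : K) := if b then - x else x.

Definition sparse_form s : ext_form K n :=
  \sum_(u <- s) u.1 *: basis_form K (mask_set u.2).

Definition sparse_scale (c : K) s := [seq (c * u.1, u.2) | u <- s].

(** The resulting mask is rebuilt with length exactly [n], so that index sets can be compared as
    sequences. *)
Definition sparse_wedge1 (u v : K * bitseq) :=
  if has (fun i => nth false u.2 i && nth false v.2 i) (iota 0 n) then [::]
  else [:: (flip_if (odd (crossings u.2 v.2)) (u.1 * v.1),
            [seq nth false u.2 i || nth false v.2 i | i <- iota 0 n])].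

Definition sparse_wedge s t :=
  flatten [seq flatten [seq sparse_wedge1 u v | v <- t] | u <- s].

Definition sparse_hodge s :=
  [seq let m := [seq ~~ nth false u.2 i | i <- iota 0 n] in
       (flip_if (odd (crossings u.2 m)) u.1, m) | u <- s].

(** A mask may occur several times in the list, hence the sum. *)
Definition sparse_coef s m := foldr (fun u x => if u.2 == m then u.1 + x else x) 0 s.

Lemma sparse_form_nil : sparse_form [::] = 0.
Proof. by rewrite /sparse_form big_nil. Qed.

Lemma sparse_form_cons u s :
  sparse_form (u :: s) = u.1 *: basis_form K (mask_set u.2) + sparse_form s.
Proof. by rewrite /sparse_form big_cons. Qed.

Lemma sparse_form_cat s t : sparse_form s + sparse_form t = sparse_form (s ++ t).
Proof. by rewrite /sparse_form big_cat. Qed.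

Lemma sparse_form_scale c s : c *: sparse_form s = sparse_form (sparse_scale c s).
Proof.
rewrite /sparse_form /sparse_scale big_map scaler_sumr.
by apply: eq_bigr => u _; rewrite scalerA.
Qed.

Lemma nth_map_iota (g : nat -> bool) (i : 'I_n) :
  nth false [seq g j | j <- iota 0 n] i = g i.
Proof. by rewrite (nth_map 0%N) ?size_iota // nth_iota. Qed.

Lemma sumn_map_iota (g : nat -> nat) :
  sumn [seq g i | i <- iota 0 n] = (\sum_(i < n) g i)%N.
Proof. by rewrite sumnE big_map -(big_mkord xpredT g) /index_iota subn0. Qed.

Lemma shuffle_sign_crossings m1 m2 :
  shuffle_sign K (mask_set m1) (mask_set m2) = (-1) ^+ odd (crossings m1 m2).
Proof.
rewrite signr_odd /shuffle_sign; congr (_ ^+ _).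
rewrite /crossings sumn_map_iota -sum1_card big_mkcond /=.
under [RHS]eq_bigr do rewrite sumn_map_iota.
by rewrite pair_bigA /=; apply: eq_bigr => -[i j] _; rewrite !inE /=; case: ifP.
Qed.

Lemma flip_ifE (b : bool) (x : K) : flip_if b x = (-1) ^+ b * x.
Proof. by case: b; rewrite /= ?expr0 ?mul1r // expr1 mulN1r. Qed.

Lemma sparse_form_wedge1 u v :
  (u.1 *: basis_form K (mask_set u.2)) \wedge (v.1 *: basis_form K (mask_set v.2)) =
  sparse_form (sparse_wedge1 u v).
Proof.
rewrite wedge_prodZl wedge_prodZr wedge_basis /sparse_wedge1.
have -> : (mask_set u.2 :&: mask_set v.2 == finset.set0) =
    ~~ has (fun i => nth false u.2 i && nth false v.2 i) (iota 0 n).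
  apply/eqP/hasPn => [uv0 i | uv0].
    rewrite mem_iota /= add0n => lin; apply/negP => uvi.
    by have := finset.in_set0 (Ordinal lin); rewrite -uv0 !inE /= uvi.
  apply/finset.setP => i; rewrite !inE; apply/negbTE/uv0.
  by rewrite mem_iota /= add0n.
case: (has _ _) => /=; first by rewrite !scaler0 sparse_form_nil.
rewrite sparse_form_cons sparse_form_nil addr0 /= flip_ifE shuffle_sign_crossings !scalerA.
congr (_ *: basis_form K _); first by ring.
by apply/finset.setP => i; rewrite !inE nth_map_iota.
Qed.

Lemma sparse_form_flatten (ss : seq (seq (K * bitseq))) :
  sparse_form (flatten ss) = \sum_(s <- ss) sparse_form s.
Proof. by rewrite /sparse_form big_flatten. Qed.

Lemma sparse_form_sum (m : nat) (g : nat -> seq (K * bitseq)) :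
  \sum_(i < m) sparse_form (g i) = sparse_form (flatten [seq g i | i <- iota 0 m]).
Proof.
rewrite sparse_form_flatten big_map -(big_mkord xpredT (fun i => sparse_form (g i))).
by rewrite /index_iota subn0.
Qed.

Lemma sparse_form_wedge s t :
  sparse_form s \wedge sparse_form t = sparse_form (sparse_wedge s t).
Proof.
have w0 b : (0 : ext_form K n) \wedge b = 0.
  by rewrite -[X in X \wedge _](scale0r (0 : ext_form K n)) wedge_prodZl scale0r.
have w0r b : b \wedge (0 : ext_form K n) = 0.
  by rewrite -[X in _ \wedge X](scale0r (0 : ext_form K n)) wedge_prodZr scale0r.
elim: s => [|u s IHs]; first by rewrite sparse_form_nil w0.
rewrite sparse_form_cons wedge_prodDl IHs {IHs} /sparse_wedge /= -sparse_form_cat.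
congr (_ + _).
elim: t => [|v t IHt]; first by rewrite sparse_form_nil w0r.
by rewrite sparse_form_cons wedge_prodDr IHt {IHt} /= -sparse_form_cat sparse_form_wedge1.
Qed.

Lemma hodgeD a b : hodge (a + b) = hodge a + hodge b.
Proof. by apply/ffunP => I; rewrite !ffunE mulrDr. Qed.

Lemma sparse_form_hodge s : hodge (sparse_form s) = sparse_form (sparse_hodge s).
Proof.
elim: s => [|u s IHs].
  by rewrite /= sparse_form_nil; apply/ffunP => I; rewrite !ffunE mulr0.
rewrite sparse_form_cons hodgeD IHs /= sparse_form_cons; congr (_ + _) => /=.
have cE : mask_set [seq ~~ nth false u.2 i | i <- iota 0 n] = (~: mask_set u.2)%SET.
  by apply/finset.setP => i; rewrite !inE nth_map_iota.
rewrite flip_ifE -shuffle_sign_crossings cE; apply/ffunP => I; rewrite !ffunE.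
rewrite (can2_eq (@finset.setCK _) (@finset.setCK _)).
case: eqP => [->|_]; last by rewrite !scaler0 mulr0.
by rewrite finset.setCK /GRing.scale /= !mulr1.
Qed.

(** On masks of length [n] the map [mask_set] is injective, so comparing masks decides equality of
    index sets. *)
Lemma sparse_form_coef s m : size m = n -> all (fun u => size u.2 == n) s ->
  sparse_form s (mask_set m) = sparse_coef s m.
Proof.
move=> sm; elim: s => [|u s IHs] /= => [_|/andP[/eqP su ss]].
  by rewrite sparse_form_nil ffunE.
rewrite sparse_form_cons ffunE {}IHs // !ffunE.
have -> : (mask_set m == mask_set u.2) = (u.2 == m).
  apply/eqP/eqP => [e|->//]; apply: (@eq_from_nth _ false); first by rewrite su sm.
  rewrite su => i lin; have /finset.setP/(_ (Ordinal lin)) := e.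
  by rewrite !inE.
by case: eqP => _; rewrite /GRing.scale /= ?mulr1 // mulr0 add0r.
Qed.

Lemma sparse_coef_notin s m : m \notin unzip2 s -> sparse_coef s m = 0.
Proof.
elim: s => //= u s IHs; rewrite in_cons negb_or => /andP[mu /IHs ->].
by rewrite eq_sym (negPf mu).
Qed.

(** Only masks occurring in [s] can carry a nonzero coefficient. Listing them explicitly in [ms]
    lets the right-hand side unfold to a finite conjunction of scalar equations. *)
Lemma sparse_form_eq0 s (ms : seq bitseq) : undup (unzip2 s) = ms ->
    all (fun m => size m == n) ms ->
  sparse_form s = 0 <-> foldr (fun m P => sparse_coef s m = 0 /\ P) True ms.
Proof.
move=> sms szms.
have szs : all (fun u => size u.2 == n) s.
  by apply/allP => u us; apply: (allP szms); rewrite -sms mem_undup map_f.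
have -> : foldr (fun m P => sparse_coef s m = 0 /\ P) True ms <->
    {in ms, forall m, sparse_coef s m = 0}.
  elim: {sms szms} ms => [|m ms IH] /=; first by split.
  rewrite IH; split=> [[m0 ms0] m'|ms0].
    by rewrite in_cons => /orP[/eqP ->|/ms0].
  by split=> [|m' m'ms]; apply: ms0; rewrite in_cons ?eqxx ?m'ms ?orbT.
split=> [s0 m mms|s0].
  have sm : size m = n by exact/eqP/(allP szms).
  by rewrite -sparse_form_coef // s0 ffunE.
apply/ffunP => I; rewrite [RHS]ffunE.
(* An arbitrary index set is brought into the form of a mask by its characteristic sequence. *)
have -> : I = mask_set [seq i \in I | i <- enum 'I_n].
  apply/finset.setP => i; rewrite inE (nth_map i) ?size_enum_ord //.
  by rewrite nth_ord_enum.
set m := map _ _; have sm : size m = n by rewrite size_map size_enum_ord.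
rewrite sparse_form_coef //; case: (boolP (m \in unzip2 s)) => [|/sparse_coef_notin //].
by rewrite -mem_undup sms => /s0.
Qed.

Lemma basis_form0_sparse : basis_form K finset.set0 = sparse_form [:: (1, nseq n false)].
Proof.
rewrite sparse_form_cons sparse_form_nil addr0 scale1r; congr basis_form.
by apply/finset.setP => j; rewrite !inE nth_nseq if_same.
Qed.

End SparseForms.

(** * The G2 forms, the curvature and the associator over a commutative ring *)

Section SparseG2.
Variable K : comNzRingType.
Implicit Types (a b w : nat -> nat -> K).

Definition sparse_covector n (i : nat) : seq (K * bitseq) :=
  [:: (1, [seq j == i | j <- iota 0 n])].

Lemma covector_sparse n (i : 'I_n) : covector i = sparse_form n (sparse_covector n i).
Proof.
rewrite sparse_form_cons sparse_form_nil addr0 scale1r; congr basis_form.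
by apply/finset.setP => j; rewrite !inE nth_map_iota.
Qed.

Definition sparse_dx := sparse_covector 7.
Definition sparse_dy k := sparse_covector 7 (3 + k).

Definition sparse_phi : seq (K * bitseq) :=
  let x := sparse_dx in
  let w k l := sparse_wedge 7 (sparse_dy k) (sparse_dy l) in
  sparse_wedge 7 (sparse_wedge 7 (x 0%N) (x 1%N)) (x 2%N) ++
  ((sparse_wedge 7 (x 0%N) (w 0%N 1%N ++ w 2%N 3%N) ++
    sparse_wedge 7 (x 1%N) (w 0%N 2%N ++ w 3%N 1%N)) ++
    sparse_wedge 7 (x 2%N) (sparse_scale (-1) (w 0%N 3%N ++ w 1%N 2%N))).

Lemma phi_sparse : phi = sparse_form 7 sparse_phi.
Proof.
rewrite /phi /omega1 /omega2 /omega3 /dx /dy !covector_sparse -scaleN1r.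
rewrite !(sparse_form_wedge, sparse_form_scale, sparse_form_cat).
by congr (sparse_form _ _).
Qed.

(* Indexing the coefficients by nat rather than by ordinals lets them be read
   off the computed sparse forms. *)
Definition curvature a b : ext_form K (3 + 4) :=
  \sum_(i < 3) \sum_(j < 3) a i j *: (dx K i \wedge dx K j)
  + \sum_(i < 3) \sum_(k < 4) b i k *: (dx K i \wedge dy K k).

Definition sparse_curvature a b : seq (K * bitseq) :=
  flatten [seq flatten [seq
      sparse_scale (a i j) (sparse_wedge 7 (sparse_dx i) (sparse_dx j))
    | j <- iota 0 3] | i <- iota 0 3] ++
  flatten [seq flatten [seq
      sparse_scale (b i k) (sparse_wedge 7 (sparse_dx i) (sparse_dy k))
    | k <- iota 0 4] | i <- iota 0 3].

Lemma curvature_sparse a b : curvature a b = sparse_form 7 (sparse_curvature a b).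
Proof.
rewrite /curvature /sparse_curvature -sparse_form_cat; congr (_ + _).
  rewrite -sparse_form_sum; apply: eq_bigr => i _.
  rewrite -sparse_form_sum; apply: eq_bigr => j _.
  by rewrite /dx !covector_sparse sparse_form_wedge sparse_form_scale.
rewrite -sparse_form_sum; apply: eq_bigr => i _.
rewrite -sparse_form_sum; apply: eq_bigr => k _.
by rewrite /dx /dy !covector_sparse sparse_form_wedge sparse_form_scale.
Qed.

(** With [a i j] the derivative of A^j along x^i, this says that dA = 0. *)
Definition symmetric_entries a :=
  [/\ a 0%N 1%N = a 1%N 0%N, a 0%N 2%N = a 2%N 0%N & a 1%N 2%N = a 2%N 1%N].

(** Spelled out as a polynomial rather than as a determinant, so that [ring] can treat it. *)
Definition minor b p q r : K :=
  b 0%N p * (b 1%N q * b 2%N r - b 1%N r * b 2%N q)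
  - b 0%N q * (b 1%N p * b 2%N r - b 1%N r * b 2%N p)
  + b 0%N r * (b 1%N p * b 2%N q - b 1%N q * b 2%N p).

(* The b i k are the partial derivatives of f; up to sign these are the dy
   components of the associator of the tangent space of the graph of f. *)
Definition fibre_associator b (k : nat) : K :=
  match k with
  | 0 => minor b 1 2 3 + b 0%N 1%N + b 1%N 2%N - b 2%N 3%N
  | 1 => minor b 0 2 3 + b 0%N 0%N + b 1%N 3%N + b 2%N 2%N
  | 2 => minor b 0 1 3 + b 0%N 3%N - b 1%N 0%N + b 2%N 1%N
  | _ => minor b 0 1 2 + b 0%N 2%N - b 1%N 1%N - b 2%N 0%N
  end.

(* The associator is orthogonal to the tangent vectors, so its dx components
   are linear combinations of the dy components. *)
Definition base_associator b j : K :=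
  b j 0%N * fibre_associator b 0 - b j 1%N * fibre_associator b 1
  + b j 2%N * fibre_associator b 2 - b j 3%N * fibre_associator b 3.

(** The value of phi on the frame e_i + sum_a b_ia e_a: the 1 comes from dx^123, and the i-th
    bracket, with its sign, is omega_i on the other two rows in cyclic order. *)
Definition phi_graph b : K :=
  1 + (b 1%N 0%N * b 2%N 1%N - b 1%N 1%N * b 2%N 0%N
       + b 1%N 2%N * b 2%N 3%N - b 1%N 3%N * b 2%N 2%N)
    + (b 2%N 0%N * b 0%N 2%N - b 2%N 2%N * b 0%N 0%N
       + b 2%N 3%N * b 0%N 1%N - b 2%N 1%N * b 0%N 3%N)
    - (b 0%N 0%N * b 1%N 3%N - b 0%N 3%N * b 1%N 0%N
       + b 0%N 1%N * b 1%N 2%N - b 0%N 2%N * b 1%N 1%N).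

Definition graph_gram b i j : K :=
  (i == j)%:R + b i 0%N * b j 0%N + b i 1%N * b j 1%N
  + b i 2%N * b j 2%N + b i 3%N * b j 3%N.

(* Harvey and Lawson's associator equality: the square of the volume is the sum
   of the squares of phi and of the associator. *)
Lemma associator_equality b : minor (graph_gram b) 0 1 2 =
  phi_graph b ^+ 2
  + (fibre_associator b 0 ^+ 2 + fibre_associator b 1 ^+ 2
     + fibre_associator b 2 ^+ 2 + fibre_associator b 3 ^+ 2)
  + (base_associator b 0 ^+ 2 + base_associator b 1 ^+ 2 + base_associator b 2 ^+ 2).
Proof.
by rewrite /minor /graph_gram /phi_graph /base_associator /fibre_associator /minor /=; ring.
Qed.

(** * Evaluation of forms on frames *)

Lemma det3_minor (A : 'M[K]_3) w : (forall i j, A i j = w i j) -> \det A = minor w 0 1 2.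
Proof.
move=> Aw; rewrite (expand_det_row _ 0) !big_ord_recl big_ord0 /cofactor.
rewrite !(expand_det_row _ 0) !big_ord_recl !big_ord0 /cofactor !det_mx11 !mxE !Aw /=.
by rewrite /minor /bump /=; ring.
Qed.

(** Only terms with exactly three indices contribute, and filtering [iota] lists these indices in
    the same increasing order as [enum]. *)
Lemma form_eval_sparse n (s : seq (K * bitseq)) (v : 'M[K]_(3, n)) w :
    (forall i j, v i j = w i j) ->
  form_eval (sparse_form n s) v = foldr (fun u x =>
    if [seq j <- iota 0 n | nth false u.2 j] is [:: p; q; r]
    then u.1 * minor w p q r + x else x) 0 s.
Proof.
move=> vw; elim: s => [|u s IHs] /=.
  by rewrite sparse_form_nil /form_eval big1 // => I _; rewrite ffunE mul0r.
rewrite sparse_form_cons -{}IHs.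
pose J := mask_set n u.2.
have -> : form_eval (u.1 *: basis_form K J + sparse_form n s) v =
    (if #|J| == 3%N then u.1 * \det (\matrix_(i < 3, j < 3) [seq v i c | c <- enum J]`_j)
     else 0) + form_eval (sparse_form n s) v.
  rewrite /form_eval; under eq_bigr => I _ do rewrite 3!ffunE mulrDl.
  rewrite big_split; congr (_ + _).
  case: ifPn => J3.
    rewrite (bigD1 J) //= big1 => [|I /andP[_ /negPf IJ]]; last first.
      by rewrite IJ scaler0 mul0r.
    by rewrite eqxx addr0 /GRing.scale /= mulr1.
  rewrite big1 // => I /eqP I3; case: eqP => [IJ|_]; last by rewrite scaler0 mul0r.
  by rewrite -IJ I3 in J3.
have JE : [seq val i | i <- enum J] = [seq j <- iota 0 n | nth false u.2 j].
  rewrite -val_enum_ord filter_map; congr map.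
  by rewrite {1}/enum_mem -enumT; apply: eq_filter => i; rewrite /= /J inE.
rewrite cardE -(size_map val) {1}JE.
case E: [seq j <- iota 0 n | nth false u.2 j] JE => [|p [|q [|r [|? ?]]]] JE;
  rewrite ?add0r //.
congr (_ * _ + _); rewrite (@det3_minor _ (fun i j => w i (nth 0%N [:: p; q; r] j))) // => i j.
rewrite mxE -JE; case: (enum J) JE => [|p' [|q' [|r' [|? ?]]]] //= _.
by case: j => [[|[|[|]]]] //= _; rewrite vw.
Qed.

(** Every k x k minor of [M *m v] is [\det M] times the corresponding minor of [v]. *)
Lemma form_eval_mulmx (k n : nat) (a : ext_form K n) (M : 'M[K]_k) (v : 'M[K]_(k, n)) :
  form_eval a (M *m v) = \det M * form_eval a v.
Proof.
rewrite /form_eval mulr_sumr; apply: eq_bigr => I /eqP Ik.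
rewrite mulrCA -det_mulmx; congr (_ * \det _); apply/matrixP => i j.
have jI : (j < size (enum I))%N by rewrite -cardE Ik.
(* [nth_map] asks for a default column; one exists because [j] is a valid position in [enum I]. *)
have c0 : 'I_n by case: (enum I) jI.
rewrite !mxE (nth_map c0) // mxE; apply: eq_bigr => l _.
by rewrite mxE (nth_map c0).
Qed.

Definition graph_frame (J : 'M[K]_(3, 4)) : 'M[K]_(3, 3 + 4) := row_mx 1%:M J.

Definition entries (J : 'M[K]_(3, 4)) (i k : nat) : K := J (inord i) (inord k).

Lemma phi_graph_frame J : form_eval phi (graph_frame J) = phi_graph (entries J).
Proof.
(* Columns 0 to 2 are the identity block; column j >= 3 is column j - 3 of [J], written
   [j.-2.-1]. *)
pose w (i j : nat) := if (j < 3)%N then (i == j)%:R else entries J i j.-2.-1.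
rewrite phi_sparse (@form_eval_sparse _ _ _ w); last first.
  move=> i j; rewrite /graph_frame /w mxE; case: splitP => j' ->.
    by rewrite mxE.
  by rewrite /entries /= !inord_val.
(* The lists are evaluated while the ring operations stay symbolic, which leaves a polynomial
   identity. *)
lazy -[GRing.opp GRing.mul GRing.one GRing.zero GRing.add minor phi_graph w entries].
by refine (_ : @eq K _ _); rewrite /minor /w /phi_graph /=; ring.
Qed.

Lemma det_graph_frame J :
  \det (graph_frame J *m (graph_frame J)^T) = minor (graph_gram (entries J)) 0 1 2.
Proof.
apply: det3_minor => i j; rewrite /graph_frame tr_row_mx mul_row_col trmx1 mul1mx !mxE.
rewrite /graph_gram -!addrA; congr (_ + _).
rewrite !big_ord_recl big_ord0 addr0 !mxE /entries !inord_val.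
by do ![congr (_ + _)|congr (_ * _)]; congr (J _ _); apply: val_inj; rewrite /= inordK.
Qed.

(** * Coefficients of the curvature equations *)

Lemma conj_eq0 (x e : K) P Q : e = x -> (P <-> Q) -> (e = 0 /\ P) <-> (x = 0 /\ Q).
Proof. by move=> -> ->. Qed.

(** Every equation below is between forms of degree n - 1, whose index sets each omit one index. *)
Definition all_but n k := [seq j != k | j <- iota 0 n].

Lemma base_curvature_eq0E a :
  \sum_(i < 3) \sum_(j < 3) a i j *: (covector i \wedge covector j : ext_form K 3) = 0 <->
  symmetric_entries a.
Proof.
pose t i j := sparse_scale (a i j)
  (sparse_wedge 3 (sparse_covector 3 i) (sparse_covector 3 j)).
under eq_bigr => i _.
  under eq_bigr => j _.
    rewrite !covector_sparse sparse_form_wedge sparse_form_scale -/(t i j).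
  over.
  rewrite (sparse_form_sum 3 3 (t i)).
over.
rewrite (sparse_form_sum 3 3 (fun i => flatten [seq t i j | j <- iota 0 3])).
(* The masks in the order in which [undup] returns them: dx^12, dx^13, dx^23, with coefficients a_ij
   - a_ji. *)
rewrite (@sparse_form_eq0 _ _ _ (map (all_but 3) [:: 2; 1; 0]%N));
  [|by vm_compute|by []].
rewrite /map /foldr.
lazy -[GRing.opp GRing.mul GRing.one GRing.zero GRing.add iff symmetric_entries].
transitivity (a 0%N 1%N - a 1%N 0%N = 0 /\ a 0%N 2%N - a 2%N 0%N = 0
   /\ a 1%N 2%N - a 2%N 1%N = 0 /\ True).
  by do 3!(apply: conj_eq0; first by ring).
split=> [[/subr0_eq ? [/subr0_eq ?] [/subr0_eq ? _]]|[-> -> ->]] //.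
by rewrite !subrr.
Qed.

Section ImaginaryUnit.
Variables (i c : K).
Hypotheses (sqr_i : i ^+ 2 = -1) (c6 : c * 6%:R = 1).

Lemma mul_imaginary_eq0 (x : K) : i * x = 0 <-> x = 0.
Proof.
split=> [ix0|->]; last by rewrite mulr0.
by rewrite -[x]opprK -[- x]mulN1r -sqr_i expr2 -mulrA ix0 mulr0 oppr0.
Qed.

(* The two correction terms vanish; they make the equation for e a polynomial
   identity, where i and c are indeterminates. *)
Lemma conj_imaginary_eq0 m (x e : K) P Q :
    e = i * x - c * 6%:R * i * m * (i ^+ 2 + 1) + (c * 6%:R - 1) * i * m ->
  (P <-> Q) -> (e = 0 /\ P) <-> (x = 0 /\ Q).
Proof.
rewrite sqr_i c6 addNr subrr mulr0 !mul0r subr0 addr0 => -> ->.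
by rewrite mul_imaginary_eq0.
Qed.

Lemma fourier_mukai_eqE a b :
  let F := curvature (fun j k => i * a j k) (fun j k => i * b j k) in
  c *: (F ^\wedge 3) + F \wedge hodge phi = 0 <->
  symmetric_entries a /\
  [/\ fibre_associator b 0 = 0, fibre_associator b 1 = 0,
      fibre_associator b 2 = 0 & fibre_associator b 3 = 0].
Proof.
move=> F; rewrite /F curvature_sparse phi_sparse /wedge_exp /iter basis_form0_sparse.
rewrite !(sparse_form_wedge, sparse_form_hodge, sparse_form_scale, sparse_form_cat).
(* Omitting an x index leaves dx^ij dy^4567, to which only F /\ dy^4567 contributes. Omitting a y
   index leaves dx^123 with three dy, where F^3 supplies the cubic part and F /\ *phi the linear
   part. *)
rewrite (@sparse_form_eq0 _ _ _ (map (all_but 7) [:: 2; 1; 0; 6; 5; 4; 3]%N));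
  [|by vm_compute|by []].
rewrite /map /foldr.
lazy -[GRing.opp GRing.mul GRing.one GRing.zero GRing.add minor fibre_associator iff
  symmetric_entries].
transitivity (a 0%N 1%N - a 1%N 0%N = 0 /\ a 0%N 2%N - a 2%N 0%N = 0
  /\ a 1%N 2%N - a 2%N 1%N = 0 /\ fibre_associator b 3 = 0 /\ fibre_associator b 2 = 0
  /\ fibre_associator b 1 = 0 /\ fibre_associator b 0 = 0 /\ True).
  (* Each coefficient is i (x - m) - 6 c i^3 m, where m is the cubic part of x: zero for the
     equations on dA, a minor for those on the associator. *)
  do 3!(apply: (conj_imaginary_eq0 (m := 0)); first by ring).
  apply: (conj_imaginary_eq0 (m := minor b 0 1 2));
    first by rewrite /fibre_associator /minor; ring.
  apply: (conj_imaginary_eq0 (m := minor b 0 1 3));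
    first by rewrite /fibre_associator /minor; ring.
  apply: (conj_imaginary_eq0 (m := minor b 0 2 3));
    first by rewrite /fibre_associator /minor; ring.
  apply: (conj_imaginary_eq0 (m := minor b 1 2 3));
    first by rewrite /fibre_associator /minor; ring.
  by [].
split; last by case=> [[-> -> ->]] [-> -> -> ->]; rewrite !subrr.
by case=> /subr0_eq ? [/subr0_eq ?] [/subr0_eq ?] [-> [-> [-> [-> _]]]].
Qed.

Lemma conj_eq0_intro (y x : K) P : y = 0 -> x = y -> P -> x = 0 /\ P.
Proof. by move=> -> ->. Qed.

(* The nonzero coefficients of phi /\ *F^2 are multiples of base_associator b j. *)
Lemma phi_hodge_sqr_eq0 a b :
  symmetric_entries a -> (forall k, fibre_associator b k = 0) ->
  let F := curvature (fun j k => i * a j k) (fun j k => i * b j k) in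
  phi \wedge hodge (F ^\wedge 2) = 0.
Proof.
move=> [a01 a02 a12] b0 F.
rewrite /F curvature_sparse phi_sparse /wedge_exp /iter basis_form0_sparse.
rewrite !(sparse_form_wedge, sparse_form_hodge, sparse_form_scale, sparse_form_cat).
apply/(@sparse_form_eq0 _ _ _ (map (all_but 7) [:: 3; 4; 5; 6; 2; 0; 1]%N));
  [by vm_compute|by []|].
rewrite /map /foldr.
lazy -[GRing.opp GRing.mul GRing.one GRing.zero GRing.add].
(* The four coefficients of dx^123 with three dy come from the dx /\ dx part of F and vanish by the
   symmetry of [a]; the three of dx^ij dy^4567 remain. *)
rewrite -a01 -a02 -a12; do 4!(apply: (@conj_eq0_intro 0); [by [] | by ring |]).
have bE j : base_associator b j = 0.
  by rewrite /base_associator !b0 !mulr0 !subr0 !addr0.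
apply: (@conj_eq0_intro (i ^+ 2 * -2%:R * base_associator b 2));
  [by rewrite bE mulr0 | by rewrite /base_associator /fibre_associator /minor; ring |].
apply: (@conj_eq0_intro (i ^+ 2 * -2%:R * base_associator b 0));
  [by rewrite bE mulr0 | by rewrite /base_associator /fibre_associator /minor; ring |].
apply: (@conj_eq0_intro (i ^+ 2 * 2%:R * base_associator b 1));
  [by rewrite bE mulr0 | by rewrite /base_associator /fibre_associator /minor; ring |].
by [].
Qed.

End ImaginaryUnit.
End SparseG2.

(** * Passage to real coefficients and the calibration condition *)

Lemma fibre_associator_rmorph (K L : comNzRingType) (h : {rmorphism K -> L})
    (b : nat -> nat -> K) k :
  fibre_associator (fun i j => h (b i j)) k = h (fibre_associator b k).
Proof.
by case: k => [|[|[|k]]]; rewrite /fibre_associator /minor !(rmorphB, rmorphD, rmorphM).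
Qed.

Lemma fibre_associator_eq0P (K : comNzRingType) (b : nat -> nat -> K) :
  (forall k, fibre_associator b k = 0) <->
  [/\ fibre_associator b 0 = 0, fibre_associator b 1 = 0,
      fibre_associator b 2 = 0 & fibre_associator b 3 = 0].
Proof. by split=> [c0|[? ? ? ?]]; [split | case=> [|[|[|k]]]]. Qed.

Section RealCoefficients.
Variable R : realType.
Implicit Types (a b : nat -> nat -> R) (J : 'M[R]_(3, 4)).

Local Notation toC := (real_complex R).

Lemma symmetric_entries_complex a :
  symmetric_entries (fun i j => toC (a i j)) <-> symmetric_entries a.
Proof.
split=> [[/complexI ? /complexI ? /complexI ?] //|[? ? ?]].
by split; congr toC.
Qed.

Lemma real_fourier_mukai_eqE a b :
  let F := curvature (fun j k => imag (a j k)) (fun j k => imag (b j k)) in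
  6%:R^-1 *: (F ^\wedge 3) + F \wedge hodge phi = 0 <->
  symmetric_entries a /\ (forall k, fibre_associator b k = 0).
Proof.
have c6 : (6%:R^-1 : R[i]) * 6%:R = 1 by rewrite mulVf // pnatr_eq0.
apply: (iff_trans (fourier_mukai_eqE (sqr_i R) c6
  (fun i j => toC (a i j)) (fun i j => toC (b i j)))).
rewrite !(fibre_associator_rmorph toC) symmetric_entries_complex fibre_associator_eq0P.
by split=> -[sa [? ? ? ?]]; split=> //; split; (apply: complexI || congr toC).
Qed.

Lemma real_phi_hodge_sqr_eq0 a b :
  symmetric_entries a -> (forall k, fibre_associator b k = 0) ->
  let F := curvature (fun j k => imag (a j k)) (fun j k => imag (b j k)) in
  phi \wedge hodge (F ^\wedge 2) = 0.
Proof.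
move=> sa b0.
apply: (@phi_hodge_sqr_eq0 _ 'i%C (fun i j => toC (a i j)) (fun i j => toC (b i j))).
  exact/symmetric_entries_complex.
by move=> k; rewrite (fibre_associator_rmorph toC) b0.
Qed.

Lemma real_base_curvature_eq0E a :
  \sum_(i < 3) \sum_(j < 3)
    imag (a i j) *: (covector i \wedge covector j : ext_form R[i] 3) = 0 <->
  symmetric_entries a.
Proof.
apply: (iff_trans (base_curvature_eq0E (fun i j => imag (a i j)))).
have imag_inj : injective (@imag R).
  have i0 : ('i%C : R[i]) != 0 by rewrite eq_complex /= oner_eq0 andbF.
  by move=> x y /(mulfI i0) /complexI.
by split=> [[/imag_inj ? /imag_inj ? /imag_inj ?] //|[? ? ?]]; split; congr imag.
Qed.

(** By the associator equality vol^2 - phi^2 is a sum of squares of associator components. Over the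
    reals it vanishes only if each of them does, and the base components are combinations of the
    fibre ones. *)
Lemma calibrated_graph_frame J :
  (forall k, fibre_associator (entries J) k = 0) <->
  form_eval phi (graph_frame J) ^+ 2 = \det (graph_frame J *m (graph_frame J)^T).
Proof.
rewrite phi_graph_frame det_graph_frame associator_equality; set b := entries J.
split=> [b0|/esym].
  by rewrite /base_associator !b0 !mulr0 !subr0 !addr0 expr0n /= !addr0.
rewrite -addrA -[RHS]addr0 => /addrI; rewrite fibre_associator_eq0P.
have := (sqr_ge0 (fibre_associator b 0), sqr_ge0 (fibre_associator b 1),
  sqr_ge0 (fibre_associator b 2), sqr_ge0 (fibre_associator b 3)).
have := (sqr_ge0 (base_associator b 0), sqr_ge0 (base_associator b 1),
  sqr_ge0 (base_associator b 2)).
move=> [[? ?] ?] [[[? ?] ?] ?] s0.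
by split; apply/eqP; rewrite -sqrf_eq0; apply/eqP; lra.
Qed.

Lemma det_graph_frame_ge0 J : 0 <= \det (graph_frame J *m (graph_frame J)^T).
Proof. by rewrite det_graph_frame associator_equality !addr_ge0 // sqr_ge0. Qed.

(** If u annihilates G G^T, then |u G|^2 = 0, so u G = 0; the identity block of G gives u = 0. *)
Lemma det_graph_frame_neq0 J : \det (graph_frame J *m (graph_frame J)^T) != 0.
Proof.
rewrite -unitfE -unitmxE -row_free_unit; apply: inj_row_free => u u0.
have := congr1 (fun M => M *m u^T) u0; rewrite mul0mx mulmxA -[_ *m u^T]mulmxA -trmx_mul.
set w := u *m _ => /matrixP/(_ 0 0); rewrite !mxE => ww0.
have w0 : w = 0.
  apply/rowP => j; rewrite [RHS]mxE; apply/eqP; rewrite -sqrf_eq0 expr2.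
  have /eqP := ww0; under eq_bigr do rewrite [w^T _ _]mxE -expr2.
  rewrite psumr_eq0 => [/allP/(_ j (mem_index_enum _))|k _]; last exact: sqr_ge0.
  by rewrite -expr2.
have := congr1 lsubmx w0; rewrite /w /graph_frame mul_mx_row row_mxKl mulmx1 => ->.
by apply/rowP => j; rewrite !mxE.
Qed.

End RealCoefficients.

(** * Smooth maps between normed spaces *)

Section Smooth.
Variables (R : realType) (V W : normedModType R).
Implicit Types (U : set V) (g : V -> W).

(** The first order expansion of [g1] at [x] is also one of [g2], and a continuous linear part in
    such an expansion is the differential. *)
Lemma near_eq_differentiable g1 g2 (x : V) :
  (\near x, g1 x = g2 x) -> differentiable g1 x -> differentiable g2 x.
Proof.
move=> g12 dg1; have g1x : g1 x = g2 x by exact: nbhs_singleton g12.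
have e2 : g2 \o shift x = cst (g2 x) + 'd g1 x +o_ 0 id.
  apply/eqaddoP => e e0.
  have n0 : \forall y \near (0 : V), g1 (y + x) = g2 (y + x).
    by move: g12; rewrite (near_shift 0) /= subr0.
  have /eqaddoP/(_ e e0) := diff_locally dg1.
  apply: filterS2 n0 => /= y g12y.
  by rewrite -[(_ - _) y]/(g1 (y + x) - _) /= g12y -g1x.
apply/diff_locallyP; have dE := diff_unique (diff_continuous dg1) e2.
by rewrite dE; split=> //; exact: diff_continuous.
Qed.

Lemma Ck_on_ext U g1 g2 k : open U -> {in U, g1 =1 g2} -> Ck_on U k g1 -> Ck_on U k g2.
Proof.
move=> oU; have nearU x h1 h2 : {in U, h1 =1 h2 :> (V -> W)} -> U x ->
    \near x, h1 x = h2 x.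
  move=> h12 Ux; have : \forall y \near x, U y by exact: open_nbhs_nbhs.
  by apply: filterS => y Uy; apply: h12; rewrite inE.
elim: k g1 g2 => [|k IH] g1 g2 g12 /=.
  move=> c1 x Ux; have n12 := nearU _ _ _ g12 Ux.
  have g1x : g1 @ x --> g1 x by exact: c1.
  rewrite (nbhs_singleton n12) in g1x.
  by apply: cvg_trans g1x; exact: near_eq_cvg.
move=> [d1 D1]; split=> [x Ux|v].
  by apply: near_eq_differentiable (d1 x Ux); exact: nearU.
apply: IH (D1 v) => x; rewrite inE => Ux.
by apply: near_eq_derive; exact: nearU.
Qed.

(** The factor [c] is there for the induction: differentiating along v turns c g(s x) into (c s)
    (D_v g)(s x). *)
Lemma Ck_on_scale U g k (c s : R) : open U -> Ck_on U k g ->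
  Ck_on [set x | U (s *: x)] k (fun x => c *: g (s *: x)).
Proof.
move=> oU; have sc : continuous (fun x : V => s *: x) by exact: scaler_continuous.
have oU' : open [set x | U (s *: x)].
  by apply: open_comp oU => x _; exact: sc.
elim: k c g => [|k IH] c g /=.
  move=> cg x Ux; apply: cvgZl_tmp; apply: (@continuous_comp _ _ _ (fun x => s *: x) g).
    exact: sc.
  exact: cg.
move=> [dg Dg].
have dc : forall x, U (s *: x) ->
    is_diff x (fun x => c *: g (s *: x)) (fun v => c *: 'd g (s *: x) (s *: v)).
  move=> x Ux; have /differentiableP dgx := dg _ Ux.
  exact: (@is_diffZ _ _ _ (fun y => g (s *: y)) (fun v => 'd g (s *: x) (s *: v))).
split=> [x Ux|v]; first by have := dc x Ux; case.
apply: (Ck_on_ext oU' _ (IH (c * s) _ (Dg v))) => x; rewrite inE /= => Ux.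
have [dd dE] := dc x Ux.
by rewrite (deriveE _ dd) dE (deriveE _ (dg _ Ux)) linearZ scalerA.
Qed.

Lemma smooth_differentiable U g x : smooth_on U g -> U x -> differentiable g x.
Proof. by move=> /(_ 1%N)[+ _]; exact. Qed.

Lemma Ck_on_cst U (w : W) k : Ck_on U k (cst w : V -> W).
Proof.
elim: k w => [|k IH] w /=; first by move=> x _; exact: cst_continuous.
split=> // v; have -> : 'D_v (cst w) = cst (0 : W); last exact: IH.
by apply/funext => x; exact: derive_cst.
Qed.

End Smooth.

Lemma smooth_scale (R : realType) (V : normedModType R) (U : set V) (s : R) :
  smooth_on U (fun u : V => s *: u).
Proof.
case=> [|k] /=; first by move=> x _; exact: scaler_continuous.
have dS x : is_diff x ( *:%R s : V -> V) ( *:%R s) by exact: is_diff_scaler.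
split=> [x _|v]; first by case: (dS x).
have -> : 'D_v (fun u => s *: u) = cst (s *: v); last exact: Ck_on_cst.
by apply/funext => x; have [dx dxE] := dS x; rewrite (deriveE _ dx) dxE.
Qed.

(** * Maps into the torus and their Jacobians *)

Section Torus.
Variable R : realType.

Lemma jacobian_row m n (h : 'rV[R]_m -> 'rV[R]_n) x i : differentiable h x ->
  row i (jacobian h x) = 'D_(delta_mx 0 i) h x.
Proof. by move=> dh; rewrite deriveEjacobian // rowE. Qed.

Lemma jacobian_shift m n (h k : 'rV[R]_m -> 'rV[R]_n) x :
  differentiable h x -> differentiable k x ->
  (\forall y \near x, h y - k y = h x - k x) -> jacobian h x = jacobian k x.
Proof.
move=> dh dk hk.
apply/row_matrixP => i; rewrite [LHS](jacobian_row i dh) [RHS](jacobian_row i dk).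
rewrite (@near_eq_derive _ _ _ h (k + cst (h x - k x))).
  rewrite deriveD ?derive_cst ?addr0 //; exact: diff_derivable.
by apply: filterS hk => y /(canRL (subrK _)) ->; rewrite addrC.
Qed.

Lemma to_torusP (u v : 'rV[R]_4) : to_torus u = to_torus v <-> lattice_rel u v.
Proof. exact: (rwP (@eqmodP _ (lattice_equiv R) u v)). Qed.

(** The difference h - k is continuous with values in the lattice, and lattice points at
    sup-distance less than 2 pi coincide. *)
Lemma lattice_locally_constant (T : topologicalType) (h k : T -> 'rV[R]_4) x :
  {for x, continuous h} -> {for x, continuous k} ->
  (\forall y \near x, to_torus (h y) = to_torus (k y)) ->
  \forall y \near x, h y - k y = h x - k x.
Proof.
move=> ch ck hk.
have cd : (fun y => h y - k y) @ x --> h x - k x by exact: cvgB.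
have pi2 : 0 < 2 * pi :> R by rewrite mulr_gt0 // pi_gt0.
have /to_torusP/asboolP[Kx xE] := nbhs_singleton hk.
move/cvg_ballP: cd => /(_ _ pi2); apply: filterS2 hk => y /to_torusP/asboolP[Ky yE].
rewrite yE xE => -[_ xy]; congr (_ *: map_mx _ _); apply/rowP => j.
have := xy 0 j; rewrite !mxE /ball /= -mulrBr normrM gtr0_norm //.
rewrite -[X in _ < X]mulr1 ltr_pM2l // -intrB -intr_norm ltrz1.
by rewrite -[1]add0r ltzD1 normr_le0 subr_eq0 eq_sym => /eqP.
Qed.

Lemma local_lift_near m (g : 'rV[R]_m -> torus R) x h : local_lift g x h ->
  \forall y \near x, local_lift g y h.
Proof.
move=> [U [oU Ux sh gh]]; have : \forall y \near x, U y by exact: open_nbhs_nbhs.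
by apply: filterS => y Uy; exists U.
Qed.

Lemma local_lift_differentiable m (g : 'rV[R]_m -> torus R) x h :
  local_lift g x h -> differentiable h x.
Proof. by move=> [U [_ Ux sh _]]; exact: smooth_differentiable sh Ux. Qed.

Lemma local_liftE m (g : 'rV[R]_m -> torus R) x h : local_lift g x h -> g x = to_torus (h x).
Proof. by move=> [U [_ Ux _]]; exact. Qed.

Lemma torus_jacobianE m (g : 'rV[R]_m -> torus R) x h :
  local_lift g x h -> torus_jacobian g x = jacobian h x.
Proof.
move=> gh; rewrite /torus_jacobian; set k := xget _ _.
have gk : local_lift g x k by apply: (@xgetPex _ _ [set h | local_lift g x h]); exists h.
have dh := local_lift_differentiable gh; have dk := local_lift_differentiable gk.
apply: jacobian_shift => //; apply: lattice_locally_constant.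
- exact: differentiable_continuous.
- exact: differentiable_continuous.
apply: filterS2 (local_lift_near gh) (local_lift_near gk) => y hy ky.
by rewrite -(local_liftE hy) -(local_liftE ky).
Qed.

Lemma jacobian_comp m n p (g : 'rV[R]_m -> 'rV[R]_n) (h : 'rV[R]_n -> 'rV[R]_p) u :
  differentiable g u -> differentiable h (g u) ->
  jacobian (h \o g) u = jacobian g u *m jacobian h (g u).
Proof.
move=> dg dh; apply/row_matrixP => i; rewrite row_mul rowE rowE.
by rewrite /jacobian !mul_rV_lin1 diff_comp.
Qed.

Lemma jacobian_scale m (s : R) (u : 'rV[R]_m) : jacobian (fun v => s *: v) u = s%:M.
Proof.
have [dx dxE] : is_diff u ( *:%R s : 'rV[R]_m -> 'rV[R]_m) ( *:%R s) by exact: is_diff_scaler.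
by apply/row_matrixP => i; rewrite !rowE /jacobian mul_rV_lin1 dxE mul_mx_scalar.
Qed.

(** Near [u] both [k] and [h \o g] lift [F], hence differ by a constant lattice vector. They are
    compared directly, so [h \o g] need only be differentiable at [u]. *)
Lemma torus_jacobian_comp m n (f : 'rV[R]_n -> torus R) (g : 'rV[R]_m -> 'rV[R]_n)
    (F : 'rV[R]_m -> torus R) u h k :
  differentiable g u -> local_lift f (g u) h -> local_lift F u k ->
  (\forall y \near u, F y = f (g y)) ->
  torus_jacobian F u = jacobian g u *m torus_jacobian f (g u).
Proof.
move=> dg fh Fk FE; rewrite (torus_jacobianE fh) (torus_jacobianE Fk).
have dh := local_lift_differentiable fh; have dk := local_lift_differentiable Fk.
have dhg : differentiable (h \o g) u by exact: differentiable_comp.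
apply: etrans (jacobian_comp dg dh); apply: (jacobian_shift dk dhg).
apply: lattice_locally_constant.
- exact: differentiable_continuous.
- exact: differentiable_continuous.
have gh : \forall y \near u, local_lift f (g y) h.
  exact: (differentiable_continuous dg (local_lift_near fh)).
apply: filterS2 (local_lift_near Fk) (filterI gh FE) => y ky [hy fe].
by rewrite -(local_liftE ky) [LHS]fe (local_liftE hy).
Qed.

Lemma local_lift_scale m (f : 'rV[R]_m -> torus R) (s : R) u h :
  local_lift f (s *: u) h -> local_lift (fun v => f (s *: v)) u (fun v => h (s *: v)).
Proof.
move=> [U [oU Uu sh fh]]; exists [set v | U (s *: v)]; split=> //.
- apply: (@open_comp _ _ (fun v : 'rV[R]_m => s *: v) U _ oU) => x _.
  exact: scaler_continuous.
- move=> k; have := Ck_on_scale 1 s oU (sh k).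
  by congr Ck_on; apply/funext => v; rewrite scale1r.
- by move=> y; exact: fh.
Qed.

End Torus.

(** * Orientation and calibration of the graph of f *)

Section Graph.
Variables (R : realType) (B : set 'rV[R]_3) (f : 'rV[R]_3 -> torus R).
Hypotheses (openB : open B) (smooth_f : torus_smooth_on B f).

Let tangent_phi x : R := form_eval phi (graph_frame (torus_jacobian f x)).

Lemma fm_curvature_entries (A : 'I_3 -> 'rV[R]_3 -> R^o) (p : ambient R) :
  fm_curvature A f p =
  curvature (fun i j => imag (partial (inord i) (A (inord j)) p.1))
            (fun i k => imag (entries (torus_jacobian f p.1) i k)).
Proof.
rewrite /fm_curvature /curvature; congr (_ + _).
  by apply: eq_bigr => i _; apply: eq_bigr => j _; rewrite !inord_val.
by apply: eq_bigr => i _; apply: eq_bigr => j _; rewrite /entries !inord_val.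
Qed.

Lemma base_curvature_entries (A : 'I_3 -> 'rV[R]_3 -> R^o) x :
  base_curvature A x = 0 <->
  symmetric_entries (fun i j => partial (inord i) (A (inord j)) x).
Proof.
rewrite -real_base_curvature_eq0E /base_curvature.
suff -> : \sum_(i < 3) \sum_(j < 3) imag (partial i (A j) x) *: (covector i \wedge covector j)
  = \sum_(i < 3) \sum_(j < 3) imag (partial (inord i) (A (inord j)) x) *:
      (covector i \wedge covector j : ext_form R[i] 3) by [].
by apply: eq_bigr => i _; apply: eq_bigr => j _; rewrite !inord_val.
Qed.

(* A local parametrization psi of the graph factors through its x-coordinates:
   psi = (id, f) o (fst o psi). *)
Lemma tangent_frame_graph (psi : 'rV[R]_3 -> ambient R) U u :
  open U -> U u -> smooth_on U (fst \o psi) -> torus_smooth_on U (snd \o psi) ->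
  (forall y, U y -> B (psi y).1 /\ (psi y).2 = f (psi y).1) ->
  tangent_frame psi u =
  jacobian (fst \o psi) u *m graph_frame (torus_jacobian f (psi u).1).
Proof.
move=> oU Uu s1 s2 psiB; rewrite /tangent_frame /graph_frame mul_mx_row mulmx1.
have [Bu _] := psiB u Uu; have [h fh] := smooth_f Bu; have [k Fk] := s2 u Uu.
have du := smooth_differentiable s1 Uu.
congr row_mx; apply: (torus_jacobian_comp du fh Fk).
have : \forall y \near u, U y by exact: open_nbhs_nbhs.
by apply: filterS => y /psiB[].
Qed.

(** A chart frame is D G with G the graph frame. Then phi gets the factor det D and vol the factor
    |det D|; squaring the calibration equation removes root and sign, and (det D)^2 cancels. *)
Lemma associative_graph_eq0 x :
  associative_for_some_orientation (graph_over B f) -> B x ->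
  forall k, fibre_associator (entries (torus_jacobian f x)) k = 0.
Proof.
move=> [P [[Pparam Pcov _] Pcal]] Bx; apply/calibrated_graph_frame.
have Sx : graph_over B f (x, f x) by [].
have [c [Pc [u Uu pu]]] := Pcov _ Sx.
have [oU [s1 s2] rf inj img] := Pparam _ Pc.
have psiS y : c.1 y -> B (c.2 y).1 /\ (c.2 y).2 = f (c.2 y).1.
  move=> Uy; have [Z oZ ZE] := img _ oU (@subset_refl _ _).
  have : (c.2 @` c.1) (c.2 y) by exists y.
  by rewrite ZE => -[].
have fr := tangent_frame_graph oU Uu s1 s2 psiS.
move: (rf u Uu) (Pcal c u Pc Uu); rewrite /= fr pu /=.
set D := jacobian _ _; set G := graph_frame _ => rfD.
(* D is invertible because its rank is at least that of the immersed frame D G, which is 3. *)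
have dD : \det D != 0.
  rewrite -unitfE -unitmxE -row_free_unit /row_free eqn_leq rank_leq_row /=.
  by apply: leq_trans (mxrankM_maxl D G); rewrite (eqP rfD).
have dE : \det (D *m G *m (D *m G)^T) = \det D ^+ 2 * \det (G *m G^T).
  by rewrite trmx_mul mulmxA -[D *m G *m G^T]mulmxA !det_mulmx det_tr; ring.
rewrite form_eval_mulmx dE => /(congr1 (fun z => z ^+ 2)).
rewrite sqr_sqrtr; last by rewrite mulr_ge0 ?sqr_ge0 ?det_graph_frame_ge0.
by rewrite exprMn => /(mulfI _); apply; rewrite sqrf_eq0.
Qed.

Lemma cvg_phi_graph (T : topologicalType) (x : T) (b : T -> nat -> nat -> R) :
  (forall i k, b y i k @[y --> x] --> b x i k) ->
  phi_graph (b y) @[y --> x] --> phi_graph (b x).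
Proof.
move=> cb.
have det2 i k j l : (b y i k * b y j l - b y i l * b y j k) @[y --> x] -->
    b x i k * b x j l - b x i l * b x j k.
  by apply: cvgB; apply: cvgM; exact: cb.
have det4 i k j l m n :
    (b y i k * b y j l - b y i l * b y j k + b y i m * b y j n - b y i n * b y j m)
    @[y --> x] -->
    b x i k * b x j l - b x i l * b x j k + b x i m * b x j n - b x i n * b x j m.
  apply: cvgB; last by apply: cvgM; exact: cb.
  by apply: cvgD; [exact: det2 | apply: cvgM; exact: cb].
rewrite /phi_graph; apply: cvgB; last exact: det4.
by apply: cvgD; [apply: cvgD; [exact: cvg_cst|]|]; exact: det4.
Qed.

(** [torus_jacobian] chooses a lift separately at each point; one lift [h] valid near [x] replaces
    all these choices, and its derivatives are continuous. *)
Lemma continuous_tangent_phi x : B x -> {for x, continuous tangent_phi}.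
Proof.
move=> Bx; have [h fh] := smooth_f Bx.
have [U [oU Ux sh _]] := fh.
pose b (y : 'rV[R]_3) (i k : nat) : R := ('D_(delta_mx 0 (inord i)) h y) 0 (inord k : 'I_4).
have bE y : local_lift f y h -> entries (torus_jacobian f y) =2 b y.
  move=> fy i k; have dh := local_lift_differentiable fy.
  rewrite /entries (torus_jacobianE fy) /b.
  have := congr1 (fun M : 'rV_4 => M 0 (inord k)) (jacobian_row (inord i) dh).
  by rewrite [LHS]mxE.
have qE : \forall y \near x, phi_graph (b y) = tangent_phi y.
  apply: filterS (local_lift_near fh) => y fy.
  by rewrite /tangent_phi phi_graph_frame /phi_graph !bE.
have cb i k : (fun y => b y i k) @ x --> b x i k.
  have [_ /(_ (delta_mx 0 (inord i))) cD] := sh 1%N; have /= cDx := cD x Ux.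
  exact: (@continuous_comp _ _ _ ('D_(delta_mx 0 (inord i)) h)
    (fun M : 'rV[R]_4 => M 0 (inord k)) x cDx (@coord_continuous _ _ _ _ _ _)).
have cphi : (fun y => phi_graph (b y)) @ x --> phi_graph (b x).
  exact: cvg_phi_graph.
rewrite [phi_graph (b x)](nbhs_singleton qE) in cphi.
exact: cvg_trans (@near_eq_cvg _ _ (nbhs x) _ _ _ qE) cphi.
Qed.

(* For s = 1 and s = -1 the two charts induce opposite orientations. *)
Let chart (s : R) : set 'rV[R]_3 * ('rV[R]_3 -> ambient R) :=
  ([set u | B (s *: u) /\ 0 < s * tangent_phi (s *: u)],
   fun u => (s *: u, f (s *: u))).

Lemma open_chart (s : R) : open (chart s).1.
Proof.
have nearB (x : 'rV[R]_3) : B x -> 0 < s * tangent_phi x ->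
    \forall y \near x, B y /\ 0 < s * tangent_phi y.
  move=> Bx qx; have nB : \forall y \near x, B y by exact: open_nbhs_nbhs.
  have cq : (fun y => s * tangent_phi y) @ x --> s * tangent_phi x.
    exact: cvgM (cvg_cst s) (continuous_tangent_phi Bx).
  exact: filterI nB (cvgr_gt _ cq _ qx).
have -> : (chart s).1 = ( *:%R s) @^-1` [set x | B x /\ 0 < s * tangent_phi x] by [].
apply: open_comp; first by move=> u _; exact: scaler_continuous.
by rewrite openE => x [Bx qx]; exact: nearB.
Qed.

Lemma smooth_chart (s : R) : torus_smooth_on (chart s).1 (snd \o (chart s).2).
Proof.
move=> v [Bv _]; have [h fh] := smooth_f Bv.
by exists (fun y => h (s *: y)); exact: local_lift_scale.
Qed.

Lemma tangent_frame_chart (s : R) u : (chart s).1 u ->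
  tangent_frame (chart s).2 u = s%:M *m graph_frame (torus_jacobian f (s *: u)).
Proof.
move=> Uu; have sm : smooth_on (chart s).1 (fst \o (chart s).2) by exact: smooth_scale.
rewrite (tangent_frame_graph (@open_chart s) Uu sm (@smooth_chart s)); last by move=> y [].
by rewrite -(jacobian_scale s u).
Qed.

Lemma local_param_chart (s : R) : s != 0 ->
  local_param (graph_over B f) (chart s).1 (chart s).2.
Proof.
move=> s0; split.
- exact: open_chart.
- by split; [exact: smooth_scale | exact: smooth_chart].
- move=> u Uu; rewrite tangent_frame_chart //; apply/row_freeP.
  exists (col_mx s^-1%:M 0).
  by rewrite -mulmxA mul_row_col mulmx0 addr0 mul1mx -scalar_mxM mulfV.
- by move=> u v _ _ [/(scalerI s0)].
(* The image of V is the part of the graph lying over s V, cut out by an open cylinder. *)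
- move=> V oV VU; exists [set p | V (s^-1 *: p.1)].
    apply: (@open_comp _ _ (fun p : ambient R => s^-1 *: p.1) V _ oV) => p _.
    have fstp : fst @ p --> p.1 by exact: cvg_fst.
    exact: cvgZl_tmp fstp.
  rewrite eqEsubset; split=> [_ [u Vu <-]|[x y] [[/= Bx ->] Vx]].
    by split; [split=> //; have [] := VU _ Vu | rewrite /= scalerK].
  by exists (s^-1 *: x) => //; rewrite /= scalerKV.
Qed.

(** Since phi^2 = vol^2 is nonzero on the graph frame, each point lies in the chart whose s is the
    sign of phi there. Charts of opposite sign have disjoint images, so the orientations agree. *)
Lemma graph_eq0_associative :
  (forall x, B x -> forall k, fibre_associator (entries (torus_jacobian f x)) k = 0) ->
  associative_for_some_orientation (graph_over B f).
Proof.
move=> chi0; pose G x := graph_frame (torus_jacobian f x).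
have phi2 x : B x -> tangent_phi x ^+ 2 = \det (G x *m (G x)^T).
  by move=> /chi0 /calibrated_graph_frame.
have phi_neq0 x : B x -> tangent_phi x != 0.
  by move=> Bx; rewrite -sqrf_eq0 phi2 // det_graph_frame_neq0.
have sign_sqr s : s = 1 \/ s = -1 -> s * s = 1 :> R by case=> ->; ring.
have sign_neq0 s : s = 1 \/ s = -1 -> s != 0 :> R.
  by case=> ->; rewrite ?oppr_eq0 oner_eq0.
exists [set c | exists2 s : R, s = 1 \/ s = -1 & c = chart s]; split; first split.
- by move=> _ [s s1 ->]; apply: local_param_chart; exact: sign_neq0.
- move=> [x y] [/= Bx ->].
  have [s s1 sphi] : exists2 s : R, s = 1 \/ s = -1 & 0 < s * tangent_phi x.
    have := phi_neq0 _ Bx; rewrite neq_lt => /orP[phix|phix].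
      by exists (-1); [right | rewrite mulN1r oppr_gt0].
    by exists 1; [left | rewrite mul1r].
  exists (chart s); split; first by exists s.
  have sx : s *: (s *: x) = x by rewrite scalerA sign_sqr // scale1r.
  exists (s *: x); first by split; rewrite sx.
  by congr pair; [|congr f].
- move=> _ _ u u' [s s1 ->] [s' s1' ->] [/= _ phiu] [/= _ phiu'] [xE _].
  (* Opposite signs would make [tangent_phi] both positive and negative at the common point. *)
  have ss' : s = s'.
    by case: s1 s1' phiu phiu' xE => -> [] -> // + + xE; rewrite xE; lra.
  rewrite ss' in xE *; rewrite (scalerI (sign_neq0 _ s1') xE).
  by exists 1%:M; rewrite ?det1 ?mul1mx.
- move=> _ u [s s1 ->] Uu; rewrite /= tangent_frame_chart //.
  have [Bu phiu] := Uu; rewrite -/(G _) form_eval_mulmx -/(tangent_phi _).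
  rewrite trmx_mul tr_scalar_mx mulmxA -[s%:M *m G _ *m _]mulmxA !det_mulmx det_scalar.
  (* In dimension 3, scaling by s = 1 or -1 multiplies phi by s^3 = s and leaves vol unchanged, so
     phi becomes |phi| = vol. *)
  have -> : s ^+ 3 = s by rewrite exprS expr2 mulrC sign_sqr // mul1r.
  rewrite mulrAC sign_sqr // mul1r -phi2 // sqrtr_sqr.
  by case: s1 phiu => ->; rewrite ?mul1r ?mulN1r ?oppr_gt0 => phiu;
    [rewrite gtr0_norm | rewrite ltr0_norm].
Qed.

End Graph.

(** * The three conditions compared pointwise over B *)

Theorem proposition4p4 (R : realType) (B : set 'rV[R]_3)
    (f : 'rV[R]_3 -> torus R) (A : 'I_3 -> 'rV[R]_3 -> R^o)
    (openB : open B) (smooth_f : torus_smooth_on B f)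
    (smooth_A : forall j, smooth_on B (A j)) :
  let S := graph_over B f in
  let F := fm_curvature A f in
  let c1 := associative_for_some_orientation S /\ flat_on A B in
  let c2 := forall p : ambient R, B p.1 ->
    6%:R^-1 *: (F p ^\wedge 3) + F p \wedge hodge phi = 0 in
  let c3 := c2 /\ forall p : ambient R, B p.1 ->
    phi \wedge hodge (F p ^\wedge 2) = 0 in
  (c1 <-> c2) /\ (c2 <-> c3).
Proof.
move=> S F c1 c2 c3.
have c2P : c2 <-> forall x, B x -> base_curvature A x = 0 /\
    (forall k, fibre_associator (entries (torus_jacobian f x)) k = 0).
  split=> [h x Bx|h p Bp].
    (* The curvature depends on p only through [p.1]; the point of the graph serves as the point
       over x. *)
    have := h (x, f x) Bx.
    rewrite /F fm_curvature_entries => /real_fourier_mukai_eqE[sa ?].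
    by split=> //; apply/base_curvature_entries.
  rewrite /F fm_curvature_entries; apply/real_fourier_mukai_eqE.
  by have [/base_curvature_entries sa ?] := h _ Bp.
split; split.
- move=> [asso flat]; apply/c2P => x Bx; split; first exact: flat.
  exact: (associative_graph_eq0 smooth_f asso Bx).
- move=> /c2P h; split; last by move=> x /h[].
  by apply: graph_eq0_associative => // x /h[].
- move=> h; split=> // p Bp; move/c2P: h => /(_ _ Bp)[/base_curvature_entries sa ch].
  by rewrite /F fm_curvature_entries; exact: real_phi_hodge_sqr_eq0.
- by case.
Qed.
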